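(* Let $U$ be a subset of $\mathbb{T}_m$ satisfying the following property: (PA) there exists $n\in\mathbb{N}$ such that for all $x\in\mathbb{T}_m$ there exist $l\in\{1,\dots,n\}$ and at least one branch starting at $x$ whose $l$-th node after $x$ belongs to $U$; that is, there are $a_1,\dots,a_l\in\{0,\dots,m-1\}$ with $(x,a_1,\dots,a_l)\in U$. Then $U$ satisfies the unique continuation property (UCP).
   Context: Let $m>2$ be an integer, $\mathbb{N}=\{1,2,\dots\}$, and let $\alpha,\beta>0$ with $\alpha+\beta=1$. The directed tree $\mathbb{T}_m$ consists of the empty sequence $\emptyset$ (the root) and all finite sequences $(a_1,\dots,a_k)$, $k\in\mathbb{N}$, with $a_i\in\{0,1,\dots,m-1\}$; its elements are called vertices. The set $\mathcal{S}(x)$ of successors of a vertex $x$ consists of the $m$ vertices obtained by appending one coordinate to $x$; $(x,a_1,\dots,a_l)$ denotes the vertex obtained by appending the coordinates $a_1,\dots,a_l$ to $x$. A function $u:\mathbb{T}_m\to\mathbb{R}$ is $p$-harmonious if for all $x\in\mathbb{T}_m$, $$u(x)=\frac{\alpha}{2}\Big\{\max_{y\in\mathcal{S}(x)}u(y)+\min_{y\in\mathcal{S}(x)}u(y)\Big\}+\frac{\beta}{m}\sum_{y\in\mathcal{S}(x)}u(y).$$ A subset $U\subset\mathbb{T}_m$ satisfies UCP if every bounded $p$-harmonious function $u$ with $u=0$ on $U$ satisfies $u\equiv0$ on $\mathbb{T}_m$. *)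

(* Defs.v *)
From HB Require Import structures.
From mathcomp Require Import all_boot all_order all_algebra.
From mathcomp Require Import all_classical all_reals all_analysis.

Set Implicit Arguments.
Unset Strict Implicit.
Unset Printing Implicit Defensive.

Import Order.TTheory GRing.Theory Num.Theory.
Import numFieldNormedType.Exports.

Local Open Scope classical_set_scope.
Local Open Scope ring_scope.

(* A vertex of the m-ary tree is the sequence of its coordinates, so the root
   is [::] and (x, a_1, ..., a_l) is x ++ [:: a_1; ...; a_l]. *)
Definition vertex (m : nat) : Type := seq 'I_m.

Definition successors (m : nat) (x : vertex m) : seq (vertex m) :=
  [seq rcons x a | a <- enum 'I_m].

(* The head is only the starting value of the fold: for nonempty s these are
   the largest and the smallest entry of s (and both are 0 for s = [::]). *)
Definition seq_max (R : realType) (s : seq R) : R :=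
  \big[Num.max/head 0 s]_(r <- s) r.

Definition seq_min (R : realType) (s : seq R) : R :=
  \big[Num.min/head 0 s]_(r <- s) r.

Definition p_harmonious (R : realType) (m : nat) (alpha beta : R)
    (u : vertex m -> R) : Prop :=
  forall x : vertex m,
    u x = alpha / 2 * (seq_max [seq u y | y <- successors x] +
                       seq_min [seq u y | y <- successors x])
          + beta / m%:R * \sum_(y <- successors x) u y.

Definition UCP (R : realType) (m : nat) (alpha beta : R)
    (U : set (vertex m)) : Prop :=
  forall u : vertex m -> R,
    bounded_fun u -> p_harmonious alpha beta u ->
    (forall x, U x -> u x = 0) -> forall x, u x = 0.

Definition PA (m : nat) (U : set (vertex m)) : Prop :=
  exists2 n : nat, (1 <= n)%N &
    forall x : vertex m, exists l : nat, (1 <= l <= n)%N /\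
      exists a : l.-tuple 'I_m, U (x ++ a).

(* Main.v *)
(* Every successor carries weight at least c = beta/m in the averaging
   operator, so if M bounds u from above then the defect M - u grows at most by
   a factor 1/c from a vertex to any successor.  Under PA each vertex has a zero
   of u at most n generations below it, hence M - u >= c^n M everywhere: an upper
   bound M >= 0 improves to (1 - c^n) M.  Applied to M = sup u this gives
   sup u <= 0, and the same argument applies to -u. *)
Require Import Defs.
From mathcomp Require Import all_boot all_order all_algebra.
From mathcomp Require Import all_classical all_reals all_analysis.
From mathcomp Require Import lra.
Import Order.TTheory GRing.Theory Num.Theory.
Local Open Scope classical_set_scope.
Local Open Scope ring_scope.

Lemma seq_max_itv (R : realType) (a b : R) (s : seq R) :
  s != [::] -> (forall r, r \in s -> a <= r <= b) -> a <= seq_max s <= b.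
Proof.
case: s => // x s _ h; rewrite /seq_max big_seq.
apply: (big_ind (fun r => a <= r <= b)) => //=.
(* The fold starts at the head, itself an entry, and not at 0, which may lie outside [[a, b]]. *)
- by apply: h; rewrite mem_head.
- by move=> p q hp hq; rewrite /Num.max; case: ifP.
Qed.

Lemma seq_min_itv (R : realType) (a b : R) (s : seq R) :
  s != [::] -> (forall r, r \in s -> a <= r <= b) -> a <= seq_min s <= b.
Proof.
case: s => // x s _ h; rewrite /seq_min big_seq.
apply: (big_ind (fun r => a <= r <= b)) => //=.
- by apply: h; rewrite mem_head.
- by move=> p q hp hq; rewrite /Num.min; case: ifP.
Qed.

Lemma big_successors (R : realType) (m : nat) (u : vertex m -> R) x :
  \sum_(y <- successors x) u y = \sum_(a < m) u (rcons x a).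
Proof. by rewrite /successors big_map big_enum. Qed.

(* Half the sum of maximum and minimum is replaced by an upper bound M of u, so
   that both u and -u satisfy this one condition when u is p-harmonious. *)
Definition sub_averaging (R : realType) (m : nat) (alpha beta : R)
    (u : vertex m -> R) : Prop :=
  forall M, (forall x, u x <= M) ->
  forall x, u x <= alpha * M + beta / m%:R * \sum_(a < m) u (rcons x a).

(** Subtracting the mean leaves [alpha] times the midpoint of maximum and minimum, which both lie in
    [[lo, hi]]. The upper half will serve [u], the lower half [- u]. *)
Lemma p_harmonious_itv (R : realType) (m : nat) (alpha beta lo hi : R)
    (u : vertex m -> R) :
  (0 < m)%N -> 0 <= alpha -> p_harmonious alpha beta u ->
  (forall x, lo <= u x <= hi) ->
  forall x, alpha * lo <= u x - beta / m%:R * \sum_(a < m) u (rcons x a)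
              <= alpha * hi.
Proof.
move=> m0 a0 hu hb x; set s := [seq u y | y <- successors x].
have s0 : s != [::].
  by rewrite -size_eq0 2!size_map size_enum_ord -lt0n.
have hs r : r \in s -> lo <= r <= hi by case/mapP => y _ ->.
have /andP[h1 h2] := seq_max_itv _ _ _ _ s0 hs.
have /andP[h3 h4] := seq_min_itv _ _ _ _ s0 hs.
rewrite {1 2}(hu x) big_successors addrK -/s.
by apply/andP; split; nra.
Qed.

Section OneSided.
Variables (R : realType) (m : nat) (alpha beta : R).
Hypotheses (m0 : (0 < m)%N) (beta0 : 0 < beta) (hab : alpha + beta = 1).
Variable u : vertex m -> R.
Hypothesis hu : sub_averaging R m alpha beta u.

Let c := beta / m%:R.

Let c_gt0 : 0 < c. Proof. by rewrite divr_gt0 ?ltr0n. Qed.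

(** Bound [u] by [M] at the other [m - 1] successors; since [alpha + m * c = 1], the terms in [M]
    add up to [(1 - c) * M]. *)
Lemma defect_successor M x a : (forall y, u y <= M) ->
  c * (M - u (rcons x a)) <= M - u x.
Proof.
move=> hM; have := hu M hM x; rewrite -/c (bigD1 a) //=.
have hs : \sum_(i < m | i != a) u (rcons x i) <= M *+ m.-1.
  apply: le_trans (ler_sum _ (fun i _ => hM (rcons x i))) _.
  by rewrite sumr_const cardC1 card_ord.
have hcm : c * (M + M *+ m.-1) = beta * M.
  by rewrite -mulrS prednK // -mulr_natl mulrA divfK // pnatr_eq0 -lt0n.
have := ler_wpM2l (ltW c_gt0) hs; have : (alpha + beta) * M = M.
  by rewrite hab mul1r.
move: hcm; rewrite mulrDl !mulrDr mulrN.
lra.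
Qed.

Lemma defect_descendant M x (s : seq 'I_m) : (forall y, u y <= M) ->
  c ^+ size s * (M - u (x ++ s)) <= M - u x.
Proof.
move=> hM; elim: s x => [|a s IH] x /=; first by rewrite cats0 expr0 mul1r.
rewrite -cat_rcons exprS -mulrA.
exact: le_trans (ler_wpM2l (ltW c_gt0) (IH (rcons x a)))
  (defect_successor M x a hM).
Qed.

Lemma sub_averaging_le0 (U : set (vertex m)) : beta <= 1 -> PA U ->
  has_ubound (range u) -> (forall x, U x -> u x = 0) -> forall x, u x <= 0.
Proof.
move=> beta1 [n n1 hP] hub hz.
have c1 : c <= 1.
  by rewrite ler_pdivrMr ?ltr0n // mul1r (le_trans beta1) // ler1n.
set S := sup (range u).
have uS x : u x <= S by apply: ub_le_sup => //; exists x.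
have S0 : 0 <= S.
  by have [l [_ [a /hz ha]]] := hP [::]; rewrite -ha.
have cn0 : 0 < c ^+ n by rewrite exprn_gt0.
have step x : u x <= (1 - c ^+ n) * S.
  have [l [/andP[_ ln] [a /hz ha]]] := hP x.
  have := defect_descendant S x a uS; rewrite ha size_tuple subr0.
  (* The depth [l] varies with [x]; as [c <= 1] and [0 <= S], the exponent [n] gives a gain uniform
     in [x]. *)
  have cnl : c ^+ n <= c ^+ l by apply: ler_wiXn2l => //; exact: ltW.
  have := ler_wpM2r S0 cnl; lra.
have : S <= (1 - c ^+ n) * S.
  by apply: ge_sup; [exists (u [::]), [::] | move=> _ [x _ <-]].
by move=> hS x; apply: le_trans (uS x) _; nra.
Qed.

End OneSided.

Theorem proposition5p3 (R : realType) (m : nat) (alpha beta : R)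
    (hm : (2 < m)%N) (halpha : 0 < alpha) (hbeta : 0 < beta)
    (hab : alpha + beta = 1) (U : set (vertex m)) (hU : PA U) :
  UCP alpha beta U.
Proof.
(* Boundedness only says that every number strictly above [B0] bounds [|u|], hence the [+ 1]. *)
move=> u [B0 [_ hB0]] hu hz x; set B := B0 + 1.
have hB y : - B <= u y <= B by rewrite -ler_norml; apply: hB0; rewrite ?ltrDl.
have m0 : (0 < m)%N by apply: leq_trans hm.
have beta1 : beta <= 1 by lra.
have avg lo hi := p_harmonious_itv R m alpha beta lo hi u m0 (ltW halpha) hu.
apply/eqP; rewrite eq_le; apply/andP; split.
  apply: (sub_averaging_le0 R m alpha beta m0 hbeta hab u _ U) => //.
    move=> M hM y; have hBM z : - B <= u z <= M by rewrite hM andbT; case/andP: (hB z).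
    have /andP[_] := avg (- B) M hBM y; lra.
  by exists B => _ [y _ <-]; case/andP: (hB y).
rewrite -oppr_le0.
apply: (sub_averaging_le0 R m alpha beta m0 hbeta hab (fun y => - u y) _ U) => //.
- move=> M hM y; rewrite sumrN.
  (* An upper bound [M] of [- u] is a lower bound [- M] of [u]. *)
  have hBM z : - M <= u z <= B by rewrite lerNl hM; case/andP: (hB z).
  have /andP[+ _] := avg (- M) B hBM y; lra.
- by exists B => _ [y _ <-]; rewrite lerNl; case/andP: (hB y).
- by move=> y /hz ->; rewrite oppr0.
Qed.
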